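(* Let $(A,\{\bullet,\bullet\}_J)$ be a Jacobi algebra over a field $k$, let $h\in A$, and assume that $r\cdot\{\bullet,\bullet\}_J=0$ for all $r\in\mathrm{Ann}_A(\{h\})$ (that is, $r\cdot\{a,b\}_J=0$ for all $a,b\in A$ and all such $r$). 1. The pair $(A,Ah\otimes A)$ is a Lie--Rinehart algebra with anchor $\rho_{Ah\otimes A}:Ah\otimes A\to\mathrm{Der}_k(A)$ given by $h\otimes a\mapsto\Phi_a$, and Lie bracket on $Ah\otimes A$ given by $$[h\otimes f,h\otimes g]_{Ah\otimes A}=h\otimes\{f,g\}_J.$$ 2. Assume there exists a right $(A,Ah\otimes A)$-connection $\nabla^r$ on $A$. (a) Then there exists some $a\in A$ satisfying $a\cdot r=\{1,r\}_J$ for all $r\in\mathrm{Ann}_A(\{h\})$. (b) Moreover, if $\nabla^r$ is flat, so that $A$ is a right $(A,Ah\otimes A)$-module extending multiplication in $A$, then for all $b\in A$ satisfying $\{1,b\}_J=0$ there exists an element $a\in A$ satisfying $a\cdot r=\{1,r\}_J$ for all $r\in\mathrm{Ann}_A(\{h\})$ and such that the following compatibility condition holds: $$\{b,a\}_J=\{1,c\}_J\quad\text{for some } c\in A.$$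
   Context: Unadorned $\otimes$ means $\otimes_k$. Algebras denoted $A$ are commutative with identity $1$. Jacobi algebra over $k$: a commutative $k$-algebra $(A,\cdot)$ with a $k$-linear Lie bracket $\{\bullet,\bullet\}_J$ satisfying $\{a\cdot b,c\}_J = a\cdot\{b,c\}_J+b\cdot\{a,c\}_J-a\cdot b\cdot\{1,c\}_J$ for all $a,b,c\in A$. For $a\in A$, $\Phi_a:=\{a,\bullet\}_J+\{1,a\}_J\cdot\bullet\in\mathrm{Der}_k(A)$. $\mathrm{Ann}_A(\{h\})=\{r\in A\mid r\cdot h=0\}$. $Ah\otimes A=(Ah)\otimes_kA$ is an $A$-module via the left tensor factor and is generated as an $A$-module by the elements $h\otimes a$, $a\in A$; the anchor is extended $A$-linearly, and the bracket is extended from these generators by skew-symmetry, additivity and the Leibniz rule for Lie--Rinehart algebras. Lie--Rinehart algebra $(A,L)$ over $k$: $A$ is a commutative $k$-algebra, $(L,[\bullet,\bullet]_L)$ a Lie algebra over $k$ with a left $A$-module structure, together with an $A$-linear Lie algebra homomorphism $\rho:L\to\mathrm{Der}_k(A)$ (the anchor) such that $[\xi,a\cdot\zeta]_L=a\cdot[\xi,\zeta]_L+\rho(\xi)(a)\cdot\zeta$ for $a\in A$, $\xi,\zeta\in L$. Right $(A,L)$-connection on $A$: a $k$-linear map $\nabla^r:A\otimes L\to A$, $a\otimes\xi\mapsto\nabla^r_\xi(a)$, with $\nabla^r_\xi(a\cdot b)=\nabla^r_{a\cdot\xi}(b)=a\cdot\nabla^r_\xi(b)-\rho(\xi)(a)\cdot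 b$ for $a,b\in A$, $\xi\in L$. It is flat if $\nabla^r_\xi\nabla^r_\zeta-\nabla^r_\zeta\nabla^r_\xi+\nabla^r_{[\xi,\zeta]_L}=0$ for all $\xi,\zeta\in L$. A flat right $(A,L)$-connection on $A$ is the same as a right $(A,L)$-module structure on $A$ extending multiplication in $A$. *)

(* Defs.v *)
From HB Require Import structures.
From mathcomp Require Import all_boot all_order all_algebra.
From mathcomp Require Import boolp sesquilinear freeg.

Set Implicit Arguments.
Unset Strict Implicit.
Unset Printing Implicit Defensive.

Import GRing.Theory.
Local Open Scope ring_scope.
Local Open Scope quotient_scope.

(* A commutative k-algebra is given as a commutative ring A with its structure
   morphism eta : k -> A, because [comAlgType k] excludes the zero algebra. *)
Section RestrictScalars.
Variables (k : pzRingType) (A : pzRingType) (eta : {rmorphism k -> A}).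
Variable L : lmodType A.

Definition restrict of {rmorphism k -> A} : Type := L.

HB.instance Definition _ := GRing.Zmodule.on (restrict eta).

Definition restrict_scale (c : k) (x : restrict eta) : restrict eta :=
  eta c *: (x : L).

Fact restrict_scaleA c d x :
  restrict_scale c (restrict_scale d x) = restrict_scale (c * d) x.
Proof.
by rewrite /restrict_scale scalerA rmorphM.
Qed.

Fact restrict_scale1 : left_id 1 restrict_scale.
Proof. by move=> x; rewrite /restrict_scale rmorph1; exact: scale1r. Qed.

Fact restrict_scaleDr : right_distributive restrict_scale +%R.
Proof. by move=> c x y; exact: scalerDr. Qed.

Fact restrict_scaleDl x : {morph restrict_scale^~ x : c d / c + d}.
Proof. by move=> c d; rewrite /restrict_scale rmorphD; exact: scalerDl. Qed.

HB.instance Definition _ := GRing.Zmodule_isLmodule.Build k (restrict eta)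
  restrict_scaleA restrict_scale1 restrict_scaleDr restrict_scaleDl.

End RestrictScalars.

Arguments restrict {k A} L eta.

Section PrincipalIdeal.
Variables (A : comPzRingType) (h : A).

Definition in_pideal : {pred A^o} := fun x => `[< exists a : A, x = a * h >].

Fact in_pideal_closed : subsemimod_closed in_pideal.
Proof.
split; first split.
- by apply/asboolP; exists 0; rewrite mul0r.
- move=> x y /asboolP[a ->] /asboolP[b ->]; apply/asboolP.
  by exists (a + b); rewrite mulrDl.
- move=> c x /asboolP[a ->]; apply/asboolP.
  by exists (c * a); rewrite -mulrA.
Qed.

HB.instance Definition _ :=
  GRing.isSubmodClosed.Build A A^o in_pideal in_pideal_closed.

Record pideal := PIdeal { pideal_val : A^o; _ : pideal_val \in in_pideal }.

HB.instance Definition _ := [isSub for pideal_val].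
HB.instance Definition _ := [Choice of pideal by <:].
HB.instance Definition _ := [SubChoice_isSubLmodule of pideal by <:].

Fact pideal_gen_subproof : h \in in_pideal.
Proof. by apply/asboolP; exists 1; rewrite mul1r. Qed.

Definition pideal_gen : pideal := PIdeal pideal_gen_subproof.

End PrincipalIdeal.

(* M (x)_k N for an A-module M and a k-vector space N, as an A-module through M:
   the free abelian group on M * N modulo biadditivity and k-balancedness. *)
Section Tensor.
Variables (k : fieldType) (A : comPzRingType) (eta : {rmorphism k -> A}).
Variables (M : lmodType A) (N : lmodType k).

Local Notation free := {freeg (M * N)%type / int}.

Definition ftens (m : M) (n : N) : free := << (m, n) >>.

Inductive tensor_rel : free -> Prop :=
| TensorRel0 : tensor_rel 0
| TensorRelB x y : tensor_rel x -> tensor_rel y -> tensor_rel (x - y)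
| TensorRelDl m m' n : tensor_rel (ftens (m + m') n - (ftens m n + ftens m' n))
| TensorRelDr m n n' : tensor_rel (ftens m (n + n') - (ftens m n + ftens m n'))
| TensorRelZ (c : k) m n :
    tensor_rel (ftens (eta c *: m) n - ftens m (c *: n)).

Definition in_tensor_rel : {pred free} := fun x => `[< tensor_rel x >].

Fact in_tensor_rel_closed : zmod_closed in_tensor_rel.
Proof.
split; first by apply/asboolP; exact: TensorRel0.
by move=> x y /asboolP hx /asboolP hy; apply/asboolP; exact: TensorRelB.
Qed.

HB.instance Definition _ :=
  GRing.isZmodClosed.Build free in_tensor_rel in_tensor_rel_closed.

Definition tensor : Type := Quotient.quot in_tensor_rel.

HB.instance Definition _ := GRing.Zmodule.on tensor.

Definition tensor_pi (x : free) : tensor := \pi_(Quotient.quot in_tensor_rel) x.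

Definition tens (m : M) (n : N) : tensor := tensor_pi (ftens m n).

Fact tensor_pi_is_zmod_morphism : zmod_morphism tensor_pi.
Proof. by move=> x y; rewrite /tensor_pi !piE. Qed.

HB.instance Definition _ :=
  GRing.isZmodMorphism.Build free tensor tensor_pi tensor_pi_is_zmod_morphism.

Lemma tensor_pi_eq x y : tensor_rel (x - y) -> tensor_pi x = tensor_pi y.
Proof.
move=> hxy; apply/eqP; rewrite /tensor_pi -Quotient.idealrBE; exact/asboolP.
Qed.

Lemma tensor_pi_rel x y : tensor_pi x = tensor_pi y -> tensor_rel (x - y).
Proof. by move/eqP; rewrite /tensor_pi -Quotient.idealrBE => /asboolP. Qed.

Lemma tensDl m m' n : tens (m + m') n = tens m n + tens m' n.
Proof. by rewrite /tens -raddfD; apply/tensor_pi_eq/TensorRelDl. Qed.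

Lemma tensDr m n n' : tens m (n + n') = tens m n + tens m n'.
Proof. by rewrite /tens -raddfD; apply/tensor_pi_eq/TensorRelDr. Qed.

Lemma tensZ (c : k) m n : tens (eta c *: m) n = tens m (c *: n).
Proof. exact/tensor_pi_eq/TensorRelZ. Qed.

Lemma freegU_int (p : M * N) (z : int) : << z *g p >> = << p >> *~ z :> free.
Proof. by rewrite freegU_mulz intz. Qed.

Lemma free_ind (P : free -> Prop) :
  P 0 -> (forall x y, P x -> P y -> P (x - y)) ->
  (forall m n, P (ftens m n)) -> forall x, P x.
Proof.
move=> P0 PB Pt x.
have PN y : P y -> P (- y) by move=> Py; rewrite -sub0r; apply: PB.
have PD y z : P y -> P z -> P (y + z).
  by move=> Py Pz; rewrite -[z]opprK; apply: PB => //; apply: PN.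
have Pn y n : P y -> P (y *+ n).
  by move=> Py; elim: n => [|n IHn]; rewrite ?mulr0n // mulrS; apply: PD.
rewrite -(freeg_sumE x); elim/big_ind: _ => // -[m n] _.
rewrite freegU_int; case: (coeff _ _) => j; first exact/Pn/Pt.
exact/PN/Pn/Pt.
Qed.

Lemma tensor_ind (P : tensor -> Prop) :
  P 0 -> (forall x y, P x -> P y -> P (x - y)) ->
  (forall m n, P (tens m n)) -> forall x, P x.
Proof.
move=> P0 PB Pt x; rewrite -[x]reprK -/(tensor_pi _).
elim/free_ind: (repr _) => [|u v Pu Pv|m n]; last exact: Pt.
- by rewrite raddf0.
- by rewrite raddfB; apply: PB.
Qed.

Section Lift.
Variables (V : zmodType) (f : M -> N -> V).

Definition balanced : Prop :=
  [/\ forall m m' n, f (m + m') n = f m n + f m' n,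
      forall m n n', f m (n + n') = f m n + f m n' &
      forall (c : k) m n, f (eta c *: m) n = f m (c *: n)].

Definition free_lift : free -> V :=
  fglift (fun p : (M * N)%type => f p.1 p.2 : zmodule V).

Fact free_lift_is_zmod_morphism : zmod_morphism free_lift.
Proof.
move=> x y; exact: (@lift_is_additive int (M * N)%type (zmodule V)
  (fun p => f p.1 p.2)).
Qed.

HB.instance Definition _ :=
  GRing.isZmodMorphism.Build free V free_lift free_lift_is_zmod_morphism.

Lemma free_liftU m n : free_lift (ftens m n) = f m n.
Proof. by rewrite /free_lift /ftens liftU. Qed.

Definition tensor_lift (t : tensor) : V := free_lift (repr t).

Hypothesis f_balanced : balanced.

Lemma free_lift_rel x : tensor_rel x -> free_lift x = 0.
Proof.
have [fDl fDr fZ] := f_balanced.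
elim=> [|u v _ hu _ hv|m m' n|m n n'|c m n]; first exact: raddf0.
- by rewrite raddfB /= hu hv subr0.
- by rewrite raddfB raddfD /= !free_liftU fDl subrr.
- by rewrite raddfB raddfD /= !free_liftU fDr subrr.
- by rewrite raddfB /= !free_liftU fZ subrr.
Qed.

Lemma tensor_lift_pi x : tensor_lift (tensor_pi x) = free_lift x.
Proof.
apply/eqP; rewrite -subr_eq0 -raddfB; apply/eqP/free_lift_rel/tensor_pi_rel.
by rewrite /tensor_pi reprK.
Qed.

Lemma tensor_liftE m n : tensor_lift (tens m n) = f m n.
Proof. by rewrite tensor_lift_pi free_liftU. Qed.

Lemma tensor_lift_is_zmod_morphism : zmod_morphism tensor_lift.
Proof.
move=> x y; rewrite -[x]reprK -[y]reprK -!/(tensor_pi _) -raddfB.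
by rewrite !tensor_lift_pi raddfB.
Qed.

Lemma tensor_lift_unique (g : tensor -> V) :
  zmod_morphism g -> (forall m n, g (tens m n) = f m n) -> g =1 tensor_lift.
Proof.
move=> gB gE x; have lB := tensor_lift_is_zmod_morphism.
elim/tensor_ind: x => [|x y hx hy|m n].
- by rewrite -(subrr 0) gB lB !subrr.
- by rewrite gB lB hx hy.
- by rewrite gE tensor_liftE.
Qed.

End Lift.

Definition tensor_scale (a : A) : tensor -> tensor :=
  tensor_lift (fun m n => tens (a *: m) n).

Fact tensor_scale_balanced a : balanced (fun m n => tens (a *: m) n).
Proof.
split=> [m m' n|m n n'|c m n].
- by rewrite scalerDr tensDl.
- by rewrite tensDr.
- by rewrite scalerA mulrC -scalerA tensZ.
Qed.

Lemma tensor_scaleE a m n : tensor_scale a (tens m n) = tens (a *: m) n.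
Proof. by rewrite /tensor_scale tensor_liftE //; exact: tensor_scale_balanced. Qed.

Fact tensor_scaleB a : zmod_morphism (tensor_scale a).
Proof. exact/tensor_lift_is_zmod_morphism/tensor_scale_balanced. Qed.

HB.instance Definition _ a :=
  GRing.isZmodMorphism.Build tensor tensor (tensor_scale a) (tensor_scaleB a).

Fact tensor_scaleA a b x :
  tensor_scale a (tensor_scale b x) = tensor_scale (a * b) x.
Proof.
elim/tensor_ind: x => [|x y hx hy|m n]; first by rewrite !raddf0.
- by rewrite !raddfB /= hx hy.
- by rewrite !tensor_scaleE scalerA.
Qed.

Fact tensor_scale1 : left_id 1 tensor_scale.
Proof.
elim/tensor_ind=> [|x y hx hy|m n]; first by rewrite raddf0.
- by rewrite raddfB /= hx hy.
- by rewrite tensor_scaleE scale1r.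
Qed.

Fact tensor_scaleDr : right_distributive tensor_scale +%R.
Proof. by move=> a x y; rewrite raddfD. Qed.

Fact tensor_scaleDl x : {morph tensor_scale^~ x : a b / a + b}.
Proof.
move=> a b; elim/tensor_ind: x => [|x y hx hy|m n].
- by rewrite !raddf0 addr0.
- by rewrite !raddfB /= hx hy opprD addrACA.
- by rewrite !tensor_scaleE scalerDl tensDl.
Qed.

HB.instance Definition _ := GRing.Zmodule_isLmodule.Build A tensor
  tensor_scaleA tensor_scale1 tensor_scaleDr tensor_scaleDl.

Lemma tensZl a m n : tens (a *: m) n = a *: tens m n.
Proof. by rewrite -tensor_scaleE. Qed.

End Tensor.

Section JacobiLieRinehart.
Variable k : fieldType.

Record is_lie_bracket (V : lmodType k) (br : V -> V -> V) : Prop := {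
  lie_bilinear : bilinear_for *:%R *:%R br;
  lie_alternating : forall x, br x x = 0;
  lie_jacobi : forall x y z,
    br x (br y z) + br y (br z x) + br z (br x y) = 0
}.

Variables (A : comPzRingType) (eta : {rmorphism k -> A}).

Local Notation A_k := (restrict A^o eta).

Record is_jacobi_bracket (J : A -> A -> A) : Prop := {
  jacobi_lie : is_lie_bracket (J : A_k -> A_k -> A_k);
  jacobi_leibniz : forall a b c,
    J (a * b) c = a * J b c + b * J a c - a * b * J 1 c
}.

Definition hamiltonian (J : A -> A -> A) (a b : A) : A := J a b + J 1 a * b.

Definition annihilator (h : A) : {pred A} := [pred r | r * h == 0].

Definition is_derivation (d : A -> A) : Prop :=
  linear (d : A_k -> A_k) /\ forall a b, d (a * b) = a * d b + d a * b.

(* The anchor L -> Der_k(A) is uncurried to L -> A -> A, with the A-module and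
   Lie structures of Der_k(A) written pointwise. *)
Record is_lie_rinehart (L : lmodType A) (br : L -> L -> L) (rho : L -> A -> A)
    : Prop := {
  lr_lie :
    is_lie_bracket (br : restrict L eta -> restrict L eta -> restrict L eta);
  lr_derivation : forall xi, is_derivation (rho xi);
  lr_anchor_linear : forall a xi zeta b,
    rho (a *: xi + zeta) b = a * rho xi b + rho zeta b;
  lr_anchor_lie : forall xi zeta b,
    rho (br xi zeta) b = rho xi (rho zeta b) - rho zeta (rho xi b);
  lr_leibniz : forall xi a zeta,
    br xi (a *: zeta) = a *: br xi zeta + rho xi a *: zeta
}.

Definition connection_domain (L : lmodType A) : lmodType A :=
  tensor eta A^o (restrict L eta).

Definition covariant (L : lmodType A) (nabla : connection_domain L -> A)
    (xi : L) (a : A) : A :=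
  nabla (tens eta (a : A^o) (xi : restrict L eta)).

Record is_right_connection (L : lmodType A) (rho : L -> A -> A)
    (nabla : connection_domain L -> A) : Prop := {
  connection_linear :
    linear (nabla : restrict (connection_domain L) eta -> A_k);
  connection_scale : forall xi a b,
    covariant nabla xi (a * b) = covariant nabla (a *: xi) b;
  connection_leibniz : forall xi a b,
    covariant nabla (a *: xi) b = a * covariant nabla xi b - rho xi a * b
}.

Definition is_flat (L : lmodType A) (br : L -> L -> L)
    (nabla : connection_domain L -> A) : Prop :=
  forall xi zeta a,
    covariant nabla xi (covariant nabla zeta a)
    - covariant nabla zeta (covariant nabla xi a)
    + covariant nabla (br xi zeta) a = 0.

Definition ideal_tensor (h : A) : lmodType A := tensor eta (pideal h) A_k.

Definition gen_tens (h a : A) : ideal_tensor h :=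
  tens eta (pideal_gen h) (a : A_k).

(* The Lie-Rinehart structures on Ah (x) A with the prescribed values on the
   A-module generators h (x) a; the Lie-Rinehart axioms determine the rest. *)
Definition is_jacobi_lie_rinehart (J : A -> A -> A) (h : A)
    (br : ideal_tensor h -> ideal_tensor h -> ideal_tensor h)
    (rho : ideal_tensor h -> A -> A) : Prop :=
  [/\ is_lie_rinehart br rho,
      forall a, rho (gen_tens h a) =1 hamiltonian J a &
      forall f g, br (gen_tens h f) (gen_tens h g) = gen_tens h (J f g)].

End JacobiLieRinehart.

Arguments is_jacobi_lie_rinehart {k A} eta J h br rho.

(* Main.v *)
Require Import Defs.
From HB Require Import structures.
From mathcomp Require Import all_boot all_order all_algebra.
From mathcomp Require Import boolp ring.

Set Implicit Arguments.
Unset Strict Implicit.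
Unset Printing Implicit Defensive.

Import GRing.Theory.
Local Open Scope ring_scope.

(** Write L for Ah (x) A, and Phi_f for the derivation attached to f.

    Existence. The A-module L is generated by the elements h (x) f, and
    x h (x) f depends on x only modulo Ann(h). So an additive map out of L is a
    biadditive, k-balanced expression in x and f that vanishes for x in Ann(h)
    ([gen_liftE], [gen_liftD]). The Leibniz rule dictates
      rho (x h (x) f) = x Phi_f,
      [h (x) f, y h (x) g] = y h (x) {f, g} + Phi_f(y) h (x) g,
      [x h (x) f, t] = x [h (x) f, t] - rho(t)(x) h (x) f,
    so [bracket] is lifted in two stages, first in the second variable
    ([gen_ad]) and then in the first. Each formula respects Ann(h): elements of
    Ann(h) kill L, and they kill the values of every rho(t) because they kill
    the Jacobi bracket. If d is a derivation and r in Ann(h) kills its values,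
    then d(r) h = d(r h) - r d(h) = 0, so that d(r) is again in Ann(h)
    ([derivation_ann]); this takes care of the terms that differentiate x or y.

    For a skew bracket with the Leibniz rule, the failure of rho to be a Lie
    morphism is A-bilinear, and once it vanishes the Jacobiator is A-trilinear.
    Both identities therefore need only be verified on the generators h (x) f
    ([lie_rinehart_of_gen]). There they read Phi_{f,g} = [Phi_f, Phi_g]
    ([hamiltonian_lie]) and the Jacobi identity of {.,.}.

    Connections. A right connection on A is determined by its values at 1:
    nabla_xi(a) = a nabla_xi(1) - rho(xi)(a) ([covariantE]). Put
    xi = h (x) 1, for which rho(xi) = {1, .}, and a = nabla_xi(1). If r h = 0
    then r xi = 0, hence 0 = nabla_(r xi)(1) = r a - {1, r}. If {1, b} = 0, then
    zeta = h (x) b commutes with xi, and flatness evaluated at 1 reads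
    rho(zeta)(a) = rho(xi)(c) with c = nabla_zeta(1), the products a c having
    cancelled; since Phi_b = {b, .}, this is {b, a} = {1, c}. *)

(** * Additive maps out of the tensor product with a principal ideal *)

Section IdealTensor.
Variables (k : fieldType) (A : comPzRingType) (eta : {rmorphism k -> A}).
Variable h : A.

Local Notation A_k := (restrict A^o eta).
Local Notation L := (ideal_tensor eta h).
Local Notation gen := (gen_tens eta h).
Local Notation Ann := (annihilator h).

Lemma pideal_coefP (m : pideal h) : exists a : A, m = a *: pideal_gen h.
Proof.
by case: m => x hx; have /asboolP[a xE] := hx; exists a; apply: val_inj.
Qed.

(** An arbitrary choice of quotient by h: only its class modulo the annihilator
    of h is meaningful. *)
Definition pideal_coef (m : pideal h) : A := projT1 (cid (pideal_coefP m)).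

Lemma pideal_coefK m : pideal_coef m *: pideal_gen h = m.
Proof. by rewrite /pideal_coef; case: cid => /= a <-. Qed.

Lemma pideal_scale_eq0 r : (r *: pideal_gen h = 0) <-> r \in Ann.
Proof.
rewrite inE; split=> [/(congr1 val) /= e|/eqP e]; first exact/eqP.
exact: val_inj.
Qed.

Lemma pideal_coefE x : pideal_coef (x *: pideal_gen h) - x \in Ann.
Proof. by apply/pideal_scale_eq0; rewrite scalerBl pideal_coefK subrr. Qed.

Lemma gen_tensZ x f : tens eta (x *: pideal_gen h) (f : A_k) = x *: gen f.
Proof. exact: tensZl. Qed.

Lemma gen_tensD f g : gen (f + g) = gen f + gen g.
Proof. exact: tensDr. Qed.

Lemma gen_tens0 : gen 0 = 0.
Proof. by apply: (addIr (gen 0)); rewrite -gen_tensD !add0r. Qed.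

Lemma gen_tens_const c f : gen (eta c * f) = eta c *: gen f.
Proof. by rewrite -gen_tensZ tensZ. Qed.

Lemma gen_tensN f : gen (- f) = - gen f.
Proof. by apply/eqP; rewrite -addr_eq0 -gen_tensD addNr gen_tens0. Qed.

(** Opposites come for free: - (x h (x) f) is (- x) h (x) f. *)
Lemma ideal_tensor_ind (P : L -> Prop) :
  (forall s t, P s -> P t -> P (s + t)) -> (forall x f, P (x *: gen f)) ->
  forall t, P t.
Proof.
move=> PD Pg t.
suff [] : P t /\ P (- t) by [].
elim/tensor_ind: t => [|s t [Ps PNs] [Pt PNt]|m f].
- by rewrite oppr0 -(scale0r (gen 0)).
- by rewrite opprB addrC; split; [rewrite addrC|]; apply: PD.
- by rewrite -[m]pideal_coefK gen_tensZ -scaleNr.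
Qed.

Lemma ann_scale r (t : L) : r \in Ann -> r *: t = 0.
Proof.
move=> /pideal_scale_eq0 rh0; elim/ideal_tensor_ind: t => [s t hs ht|x f].
  by rewrite scalerDr hs ht addr0.
rewrite scalerA mulrC -scalerA -gen_tensZ rh0 -(scale0r (pideal_gen h)).
by rewrite gen_tensZ scale0r scaler0.
Qed.

Section GenLift.
Variables (V : zmodType) (F : A -> A -> V).

(** The presentation of L in terms of pairs (x, f) standing for x h (x) f: the
    last clause accounts for the relations x h = y h. *)
Definition ann_balanced : Prop :=
  [/\ forall x y f, F (x + y) f = F x f + F y f,
      forall x f g, F x (f + g) = F x f + F x g,
      forall c x f, F (eta c * x) f = F x (eta c * f) &
      forall r f, r \in Ann -> F r f = 0].

Definition gen_lift : L -> V :=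
  tensor_lift (fun (m : pideal h) (f : A_k) => F (pideal_coef m) f).

Hypothesis F_balanced : ann_balanced.

Lemma ann_balanced_coef x f : F (pideal_coef (x *: pideal_gen h)) f = F x f.
Proof.
have [FD _ _ F0] := F_balanced.
by rewrite -{1}[pideal_coef _](subrK x) FD F0 ?add0r //; exact: pideal_coefE.
Qed.

Lemma gen_lift_balanced :
  balanced eta (fun (m : pideal h) (f : A_k) => F (pideal_coef m) f).
Proof.
have [FDl FDr Fc _] := F_balanced; split=> [m m' f|m f g|c m f].
- rewrite -[m]pideal_coefK -[m']pideal_coefK -scalerDl.
  by rewrite !ann_balanced_coef FDl.
- exact: FDr.
- by rewrite -[m]pideal_coefK scalerA !ann_balanced_coef Fc.
Qed.

(** With [gen_liftD], the universal property of L: the choice made in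
    [pideal_coef] disappears. *)
Lemma gen_liftE x f : gen_lift (x *: gen f) = F x f.
Proof.
rewrite -gen_tensZ /gen_lift tensor_liftE ?ann_balanced_coef //.
exact: gen_lift_balanced.
Qed.

Lemma gen_liftD s t : gen_lift (s + t) = gen_lift s + gen_lift t.
Proof.
have lB x y : gen_lift (x - y) = gen_lift x - gen_lift y.
  exact: (tensor_lift_is_zmod_morphism gen_lift_balanced).
have l0 : gen_lift 0 = 0 by rewrite -[X in gen_lift X](subrr (0 : L)) lB subrr.
by rewrite -{1}[t]opprK lB -[- t]add0r lB l0 sub0r opprK.
Qed.

End GenLift.
End IdealTensor.

(** * Derivations *)

Section Derivations.
Variables (k : fieldType) (A : comPzRingType) (eta : {rmorphism k -> A}).
Variable d : A -> A.
Hypothesis d_der : is_derivation eta d.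

Lemma derivationM a b : d (a * b) = a * d b + d a * b.
Proof. by case: d_der. Qed.

Lemma derivationD a b : d (a + b) = d a + d b.
Proof.
case: d_der => dlin _; have := dlin 1 a b.
by rewrite !scale1r.
Qed.

Lemma derivation0 : d 0 = 0.
Proof. by apply: (addIr (d 0)); rewrite -derivationD !add0r. Qed.

Lemma derivationN a : d (- a) = - d a.
Proof. by apply/eqP; rewrite -addr_eq0 -derivationD addNr derivation0. Qed.

Lemma derivation_const_scale c a : d (eta c * a) = eta c * d a.
Proof.
case: d_der => dlin _; have := dlin c a 0; rewrite !addr0 => e.
by apply: etrans e _; rewrite [X in _ + X]derivation0 addr0.
Qed.

Lemma derivation1 : d 1 = 0.
Proof.
have := derivationM 1 1; rewrite !mul1r mulr1 => e.
by apply: (addrI (d 1)); rewrite addr0 -e.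
Qed.

Lemma derivation_const c : d (eta c) = 0.
Proof. by rewrite -[eta c]mulr1 derivation_const_scale derivation1 mulr0. Qed.

(** Because d(r) h = d(r h) - r d(h). Differentiating a coefficient therefore
    preserves its class modulo the annihilator, which makes the formulas of
    [gen_ad] and [bracket] well defined. *)
Lemma derivation_ann h r :
  (forall b, r * d b = 0) -> r \in annihilator h -> d r \in annihilator h.
Proof.
move=> rd0; rewrite !inE => /eqP rh0; have := derivationM r h.
by rewrite rh0 derivation0 rd0 add0r => <-.
Qed.

End Derivations.

(** * Jacobi brackets and hamiltonian derivations *)

Section JacobiBracket.
Variables (k : fieldType) (A : comPzRingType) (eta : {rmorphism k -> A}).
Variable J : A -> A -> A.
Hypothesis J_jacobi : is_jacobi_bracket eta J.

Local Notation Phi := (hamiltonian J).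

Lemma jacobi_alternating a : J a a = 0.
Proof. exact: lie_alternating (jacobi_lie J_jacobi) a. Qed.

Lemma jacobiDl a b c : J (a + b) c = J a c + J b c.
Proof.
have bil := fst (lie_bilinear (jacobi_lie J_jacobi)).
have e : J (eta 1 * a + b) c = eta 1 * J a c + J b c := bil c 1 a b.
by rewrite rmorph1 !mul1r in e.
Qed.

Lemma jacobiDr a b c : J a (b + c) = J a b + J a c.
Proof.
have bil := snd (lie_bilinear (jacobi_lie J_jacobi)).
have e : J a (eta 1 * b + c) = eta 1 * J a b + J a c := bil a 1 b c.
by rewrite rmorph1 !mul1r in e.
Qed.

Lemma jacobi_skew a b : J a b = - J b a.
Proof.
apply/eqP; rewrite -addr_eq0; apply/eqP.
have := jacobi_alternating (a + b).
by rewrite jacobiDl !jacobiDr !jacobi_alternating add0r addr0.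
Qed.

Lemma jacobi0r a : J a 0 = 0.
Proof. by apply: (addIr (J a 0)); rewrite -jacobiDr !add0r. Qed.

Lemma jacobiNr a b : J a (- b) = - J a b.
Proof. by apply/eqP; rewrite -addr_eq0 -jacobiDr addNr jacobi0r. Qed.

Lemma jacobi_const_r c a b : J a (eta c * b) = eta c * J a b.
Proof.
have bil := snd (lie_bilinear (jacobi_lie J_jacobi)).
have e : J a (eta c * b + 0) = eta c * J a b + J a 0 := bil a c b 0.
by rewrite jacobi0r !addr0 in e.
Qed.

Lemma jacobi_const_l c a b : J (eta c * a) b = eta c * J a b.
Proof. by rewrite jacobi_skew jacobi_const_r -mulrN -jacobi_skew. Qed.

Lemma jacobi_leibniz_r a b c :
  J a (b * c) = b * J a c + c * J a b + b * c * J 1 a.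
Proof.
rewrite jacobi_skew (jacobi_leibniz J_jacobi) (jacobi_skew c a).
by rewrite (jacobi_skew b a); ring.
Qed.

Lemma jacobi_ad a b c : J (J a b) c = J a (J b c) - J b (J a c).
Proof.
have e : J a (J b c) + J b (J c a) + J c (J a b) = 0.
  exact: (lie_jacobi (jacobi_lie J_jacobi)).
apply/eqP; rewrite -subr_eq0 -[X in _ == X]oppr0 -e; apply/eqP.
by rewrite (jacobi_skew c a) jacobiNr (jacobi_skew c (J a b)); ring.
Qed.

(** J a is a first order operator with value - J 1 a at 1; adding multiplication
    by J 1 a makes it kill 1, hence a derivation. *)
Lemma hamiltonian_derivation a : is_derivation eta (Phi a).
Proof.
split=> [c u v|b c]; rewrite /hamiltonian.
  change (J a (eta c * u + v) + J 1 a * (eta c * u + v) =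
    eta c * (J a u + J 1 a * u) + (J a v + J 1 a * v)).
  by rewrite jacobiDr jacobi_const_r; ring.
by rewrite jacobi_leibniz_r; ring.
Qed.

Lemma hamiltonianDl a b c : Phi (a + b) c = Phi a c + Phi b c.
Proof. by rewrite /hamiltonian jacobiDl jacobiDr; ring. Qed.

Lemma hamiltonian_const_l c a b : Phi (eta c * a) b = eta c * Phi a b.
Proof. by rewrite /hamiltonian jacobi_const_l jacobi_const_r; ring. Qed.

(** Both sides have the leading part J (J a b); their zeroth order parts agree
    because J 1 is a derivation of the bracket J. *)
Lemma hamiltonian_lie a b c :
  Phi (J a b) c = Phi a (Phi b c) - Phi b (Phi a c).
Proof.
rewrite /hamiltonian jacobi_ad !jacobiDr !jacobi_leibniz_r.
have -> : J 1 (J a b) = J a (J 1 b) - J b (J 1 a).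
  have := jacobi_ad 1 a b; rewrite (jacobi_skew (J 1 a)) => e.
  by rewrite -[LHS](subrK (J a (J 1 b))) -e addrC.
ring.
Qed.

End JacobiBracket.

(** * Lie-Rinehart axioms from generators *)

Section GeneratorCriterion.
Variables (k : fieldType) (A : comPzRingType) (eta : {rmorphism k -> A}).
Variables (L : lmodType A) (I : Type) (gen : I -> L).
Variables (br : L -> L -> L) (rho : L -> A -> A).

Hypothesis gen_ind : forall P : L -> Prop,
  (forall s t, P s -> P t -> P (s + t)) -> (forall a s, P s -> P (a *: s)) ->
  (forall i, P (gen i)) -> forall s, P s.
Hypothesis brDr : forall s t t', br s (t + t') = br s t + br s t'.
Hypothesis br_leibniz :
  forall s a t, br s (a *: t) = a *: br s t + rho s a *: t.
Hypothesis rhoD : forall s t b, rho (s + t) b = rho s b + rho t b.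
Hypothesis rhoZ : forall a s b, rho (a *: s) b = a * rho s b.
Hypothesis rho_derivation : forall s, is_derivation eta (rho s).
Hypothesis br_skew : forall s t, br s t = - br t s.
Hypothesis gen_alternating : forall i, br (gen i) (gen i) = 0.
Hypothesis gen_anchor_lie : forall i j b,
  rho (br (gen i) (gen j)) b =
  rho (gen i) (rho (gen j) b) - rho (gen j) (rho (gen i) b).
Hypothesis gen_jacobi : forall i j l,
  br (gen i) (br (gen j) (gen l)) + br (gen j) (br (gen l) (gen i))
  + br (gen l) (br (gen i) (gen j)) = 0.

Lemma brDl s s' t : br (s + s') t = br s t + br s' t.
Proof. by rewrite br_skew brDr opprD -!(br_skew _ t). Qed.

Lemma brZl a s t : br (a *: s) t = a *: br s t - rho t a *: s.
Proof. by rewrite br_skew br_leibniz opprD -scalerN -br_skew. Qed.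

(** Skew-symmetry alone would not suffice in characteristic 2; but it makes the
    isotropic elements stable under sums, and the Leibniz rule gives
    [a s, a s] = a^2 [s, s]. *)
Lemma alternating_of_gen s : br s s = 0.
Proof.
elim/gen_ind: s => [s t hs ht|a s hs|i]; last exact: gen_alternating.
  by rewrite brDl !brDr hs ht add0r addr0 (br_skew t) subrr.
by rewrite brZl br_leibniz hs scaler0 add0r rhoZ scalerA subrr.
Qed.

(** The defect rho([s, t]) - [rho(s), rho(t)] is A-linear in t by the Leibniz
    rule, and in s by skew-symmetry. *)
Lemma anchor_lie_of_gen s t b :
  rho (br s t) b = rho s (rho t b) - rho t (rho s b).
Proof.
have rhoN u c : rho (- u) c = - rho u c by rewrite -scaleN1r rhoZ mulN1r.
pose P s t := forall b, rho (br s t) b = rho s (rho t b) - rho t (rho s b).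
have PC u v : P u v -> P v u.
  by move=> Puv c; rewrite br_skew rhoN Puv opprB.
have PD u v v' : P u v -> P u v' -> P u (v + v').
  move=> Pv Pv' c; rewrite brDr !rhoD Pv Pv'.
  by rewrite (derivationD (rho_derivation u)); ring.
have PZ u a v : P u v -> P u (a *: v).
  move=> Pv c; rewrite br_leibniz rhoD !rhoZ Pv.
  by rewrite (derivationM (rho_derivation u)); ring.
suff : P s t by exact.
elim/gen_ind: t => [t t'|a t|j]; [exact: PD|exact: PZ|].
apply: PC; elim/gen_ind: s => [s s'|a s|i]; [exact: PD|exact: PZ|].
exact: gen_anchor_lie.
Qed.

(** In the Jacobiator of (s, t, a u) the derivatives of a cancel, the second
    order ones by [anchor_lie_of_gen]; it is thus A-linear in its last variable,
    and by cyclic invariance in all three. *)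
Lemma jacobi_of_gen s t u :
  br s (br t u) + br t (br u s) + br u (br s t) = 0.
Proof.
pose P s t u := br s (br t u) + br t (br u s) + br u (br s t) = 0.
have Prot s' t' u' : P s' t' u' -> P t' u' s'.
  by rewrite /P => <-; rewrite -[RHS]addrA [RHS]addrC.
have PD s' t' u1 u2 : P s' t' u1 -> P s' t' u2 -> P s' t' (u1 + u2).
  rewrite /P => P1 P2; rewrite !(brDl, brDr).
  by rewrite (AC (2*2*2) ((1*3*5)*(2*4*6))) /= P1 P2 addr0.
have PZ s' t' a v : P s' t' v -> P s' t' (a *: v).
  rewrite /P => Pv; rewrite br_leibniz !brZl brDr !br_leibniz.
  rewrite -[- (_ *: v)]scaleNr brDr !br_leibniz.
  rewrite (derivationN (rho_derivation t')) anchor_lie_of_gen.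
  rewrite (_ : rho t' a *: br v s' = - (rho t' a *: br s' v)); last first.
    by rewrite br_skew scalerN.
  (* 1, 5, 9: a times the Jacobiator; 2, 7 and 3, 6: first derivatives of a;
     4, 8, 10: second derivatives of a *)
  rewrite !scaleNr (AC (2*2*(2*2)*2) ((1*5*9)*(2*7)*(3*6)*(4*8*10))) /=.
  by rewrite -!scalerDr Pv scaler0 !subrr -scalerBl subrr !addr0.
(* cyclic invariance brings each variable in turn to the last place *)
suff : P s t u by [].
elim/gen_ind: u => [u u'|a u|l]; [exact: PD|exact: PZ|].
apply: (Prot); apply: (Prot).
elim/gen_ind: s => [s s'|a s|i]; [exact: PD|exact: PZ|].
apply: (Prot); apply: (Prot).
elim/gen_ind: t => [t t'|a t|j]; [exact: PD|exact: PZ|].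
exact: gen_jacobi.
Qed.

Lemma lie_rinehart_of_gen : is_lie_rinehart eta br rho.
Proof.
split=> [|//|a s t b|s t b|s a t].
- split; [split=> u c s t | exact: alternating_of_gen | exact: jacobi_of_gen].
    change (br (eta c *: s + t) u = eta c *: br s u + br t u).
    by rewrite brDl brZl (derivation_const (rho_derivation u)) scale0r subr0.
  change (br u (eta c *: s + t) = eta c *: br u s + br u t).
  rewrite brDr br_leibniz (derivation_const (rho_derivation u)).
  by rewrite scale0r addr0.
- by rewrite rhoD rhoZ.
- exact: anchor_lie_of_gen.
- exact: br_leibniz.
Qed.

End GeneratorCriterion.

(** * The Lie-Rinehart structure of a Jacobi algebra *)

Section LieRinehart.
Variables (k : fieldType) (A : comPzRingType) (eta : {rmorphism k -> A}).
Variables (J : A -> A -> A) (h : A).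
Hypothesis J_jacobi : is_jacobi_bracket eta J.
Hypothesis annJ : forall r, r \in annihilator h -> forall a b, r * J a b = 0.

Local Notation Phi := (hamiltonian J).
Local Notation L := (ideal_tensor eta h).
Local Notation gen := (gen_tens eta h).
Local Notation Ann := (annihilator h).

Lemma ann_hamiltonian r a b : r \in Ann -> r * Phi a b = 0.
Proof.
by move=> rh; rewrite /hamiltonian mulrDr mulrA !annJ // mul0r addr0.
Qed.

Definition anchor (s : L) (b : A) : A := gen_lift (fun x f => x * Phi f b) s.

Lemma anchor_balanced b :
  ann_balanced eta h (fun x f => x * Phi f b : A).
Proof.
split=> [x y f|x f g|c x f|r f rh].
- by rewrite mulrDl.
- by rewrite (hamiltonianDl J_jacobi) mulrDr.
- by rewrite (hamiltonian_const_l J_jacobi) mulrCA mulrA.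
- exact: ann_hamiltonian.
Qed.

Lemma anchorE x f b : anchor (x *: gen f) b = x * Phi f b.
Proof. exact: (gen_liftE (anchor_balanced b)). Qed.

Lemma anchorD s t b : anchor (s + t) b = anchor s b + anchor t b.
Proof. exact: (gen_liftD (anchor_balanced b)). Qed.

Lemma anchor_gen f b : anchor (gen f) b = Phi f b.
Proof. by rewrite -[gen f]scale1r anchorE mul1r. Qed.

Lemma anchorZ a s b : anchor (a *: s) b = a * anchor s b.
Proof.
elim/ideal_tensor_ind: s => [s t hs ht|x f].
  by rewrite scalerDr !anchorD hs ht mulrDr.
by rewrite scalerA !anchorE mulrA.
Qed.

Lemma anchor_derivation s : is_derivation eta (anchor s).
Proof.
elim/ideal_tensor_ind: s => [s t hs ht|x f]; split=> [c u v|a b].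
- change (anchor (s + t) (eta c * u + v) =
    eta c * anchor (s + t) u + anchor (s + t) v).
  rewrite !anchorD !(derivationD hs) !(derivationD ht).
  by rewrite (derivation_const_scale hs) (derivation_const_scale ht); ring.
- by rewrite !anchorD (derivationM hs) (derivationM ht); ring.
- change (anchor (x *: gen f) (eta c * u + v) =
    eta c * anchor (x *: gen f) u + anchor (x *: gen f) v).
  have fder := hamiltonian_derivation J_jacobi f.
  by rewrite !anchorE (derivationD fder) (derivation_const_scale fder); ring.
- rewrite !anchorE (derivationM (hamiltonian_derivation J_jacobi f)); ring.
Qed.

Lemma ann_anchor r s b : r \in Ann -> r * anchor s b = 0.
Proof.
move=> rh; elim/ideal_tensor_ind: s => [s t hs ht|x f].
  by rewrite anchorD mulrDr hs ht addr0.
by rewrite anchorE mulrCA ann_hamiltonian ?mulr0.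
Qed.

(** The operator [h (x) f, .], as the Leibniz rule forces it on multiples of the
    generators. *)
Definition gen_ad (f : A) (t : L) : L :=
  gen_lift (fun y g => y *: gen (J f g) + Phi f y *: gen g) t.

Lemma gen_ad_balanced f :
  ann_balanced eta h (fun y g => y *: gen (J f g) + Phi f y *: gen g : L).
Proof.
have fder := hamiltonian_derivation J_jacobi f.
split=> [x y g|x g g'|c x g|r g rh].
- by rewrite (derivationD fder) !scalerDl addrACA.
- by rewrite (jacobiDr J_jacobi) !gen_tensD !scalerDr addrACA.
- rewrite (derivation_const_scale fder) (jacobi_const_r J_jacobi).
  by rewrite !gen_tens_const !scalerA ![_ * eta c]mulrC.
- rewrite ann_scale // add0r ann_scale //.
  by apply: (derivation_ann fder) => // b; apply: ann_hamiltonian.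
Qed.

Lemma gen_adE f y g :
  gen_ad f (y *: gen g) = y *: gen (J f g) + Phi f y *: gen g.
Proof. exact: (gen_liftE (gen_ad_balanced f)). Qed.

Lemma gen_adD f s t : gen_ad f (s + t) = gen_ad f s + gen_ad f t.
Proof. exact: (gen_liftD (gen_ad_balanced f)). Qed.

Lemma gen_ad_gen f g : gen_ad f (gen g) = gen (J f g).
Proof.
have fder := hamiltonian_derivation J_jacobi f.
by rewrite -[gen g]scale1r gen_adE (derivation1 fder) scale0r addr0 scale1r.
Qed.

Lemma gen_adZ f a s : gen_ad f (a *: s) = a *: gen_ad f s + Phi f a *: s.
Proof.
elim/ideal_tensor_ind: s => [s t hs ht|y g].
  by rewrite scalerDr !gen_adD hs ht !scalerDr addrACA.
rewrite scalerA !gen_adE (derivationM (hamiltonian_derivation J_jacobi f)).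
by rewrite scalerDl scalerDr !scalerA addrA.
Qed.

Lemma gen_adDl f g s : gen_ad (f + g) s = gen_ad f s + gen_ad g s.
Proof.
elim/ideal_tensor_ind: s => [s t hs ht|y e].
  by rewrite !gen_adD hs ht addrACA.
rewrite !gen_adE (jacobiDl J_jacobi) (hamiltonianDl J_jacobi).
by rewrite gen_tensD scalerDl scalerDr addrACA.
Qed.

Lemma gen_ad_const_l c f s : gen_ad (eta c * f) s = eta c *: gen_ad f s.
Proof.
elim/ideal_tensor_ind: s => [s t hs ht|y e].
  by rewrite !gen_adD hs ht scalerDr.
rewrite !gen_adE (jacobi_const_l J_jacobi) (hamiltonian_const_l J_jacobi).
by rewrite gen_tens_const scalerDr !scalerA [y * _]mulrC.
Qed.

(** Skew-symmetry and the Leibniz rule force this formula; its second term is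
    the derivative of the coefficient x along t. *)
Definition bracket (s t : L) : L :=
  gen_lift (fun x f => x *: gen_ad f t - anchor t x *: gen f) s.

Lemma bracket_balanced t :
  ann_balanced eta h (fun x f => x *: gen_ad f t - anchor t x *: gen f : L).
Proof.
have tder := anchor_derivation t.
split=> [x y f|x f g|c x f|r f rh].
- by rewrite (derivationD tder) !scalerDl opprD addrACA.
- by rewrite gen_adDl gen_tensD !scalerDr opprD addrACA.
- rewrite (derivation_const_scale tder) gen_ad_const_l gen_tens_const.
  by rewrite !scalerA ![_ * eta c]mulrC.
- rewrite ann_scale // sub0r ann_scale ?oppr0 //.
  by apply: (derivation_ann tder) => // b; apply: ann_anchor.
Qed.

Lemma bracketE x f t :
  bracket (x *: gen f) t = x *: gen_ad f t - anchor t x *: gen f.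
Proof. exact: (gen_liftE (bracket_balanced t)). Qed.

Lemma bracketDl s s' t : bracket (s + s') t = bracket s t + bracket s' t.
Proof. exact: (gen_liftD (bracket_balanced t)). Qed.

Lemma bracketDr s t t' : bracket s (t + t') = bracket s t + bracket s t'.
Proof.
elim/ideal_tensor_ind: s => [s s' hs hs'|x f].
  by rewrite !bracketDl hs hs' addrACA.
by rewrite !bracketE gen_adD anchorD scalerDr scalerDl opprD addrACA.
Qed.

Lemma bracket_gen f g : bracket (gen f) (gen g) = gen (J f g).
Proof.
rewrite -{1}[gen f]scale1r bracketE gen_ad_gen.
by rewrite (derivation1 (anchor_derivation _)) scale0r subr0 scale1r.
Qed.

Lemma bracketZr s a t : bracket s (a *: t) = a *: bracket s t + anchor s a *: t.
Proof.
elim/ideal_tensor_ind: s => [s s' hs hs'|x f].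
  by rewrite !bracketDl hs hs' anchorD scalerDr scalerDl addrACA.
rewrite !bracketE gen_adZ anchorZ anchorE scalerDr scalerBr !scalerA.
by rewrite [a * x]mulrC addrAC.
Qed.

Lemma bracket_skew s t : bracket s t = - bracket t s.
Proof.
elim/ideal_tensor_ind: s => [s s' hs hs'|x f].
  by rewrite bracketDl bracketDr hs hs' opprD.
elim/ideal_tensor_ind: t => [t t' ht ht'|y g].
  by rewrite bracketDl bracketDr ht ht' opprD.
rewrite !bracketE !gen_adE !anchorE !scalerDr !scalerA.
rewrite (jacobi_skew J_jacobi g f) gen_tensN scalerN [y * x]mulrC.
by rewrite [RHS]opprB opprD opprK [RHS]addrCA addrA.
Qed.

Lemma jacobi_lie_rinehart : is_jacobi_lie_rinehart eta J h bracket anchor.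
Proof.
split; [|exact: anchor_gen|exact: bracket_gen].
apply: (lie_rinehart_of_gen (gen := gen)).
- by move=> P PD PZ Pg; apply: ideal_tensor_ind => // x f; apply: PZ.
- exact: bracketDr.
- exact: bracketZr.
- exact: anchorD.
- exact: anchorZ.
- exact: anchor_derivation.
- exact: bracket_skew.
- by move=> f; rewrite bracket_gen (jacobi_alternating J_jacobi) gen_tens0.
- by move=> f g b; rewrite bracket_gen !anchor_gen (hamiltonian_lie J_jacobi).
- move=> f g e; rewrite !bracket_gen -!gen_tensD -(gen_tens0 eta h).
  by congr gen; exact: (lie_jacobi (jacobi_lie J_jacobi)).
Qed.

End LieRinehart.

(** * Right connections on the base algebra *)

Section RightConnection.
Variables (k : fieldType) (A : comPzRingType) (eta : {rmorphism k -> A}).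
Variables (L : lmodType A) (br : L -> L -> L) (rho : L -> A -> A).
Variable nabla : connection_domain eta L -> A.
Hypothesis brP : is_lie_rinehart eta br rho.
Hypothesis nablaP : is_right_connection rho nabla.

Lemma covariant0 a : covariant nabla 0 a = 0.
Proof.
have := connection_leibniz nablaP 0 0 a.
by rewrite scale0r (derivation0 (lr_derivation brP 0)) !mul0r subr0.
Qed.

(** A right connection on A is minus its anchor up to a multiplication operator;
    the values at 1 determine everything. *)
Lemma covariantE xi a :
  covariant nabla xi a = a * covariant nabla xi 1 - rho xi a.
Proof.
rewrite -{1}[a]mulr1 (connection_scale nablaP) (connection_leibniz nablaP).
by rewrite mulr1.
Qed.

(** By [covariantE] the difference of the two sides is nabla_xi(r), which is also
    nabla_(r xi)(1). *)
Lemma covariant_torsion xi r :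
  r *: xi = 0 -> covariant nabla xi 1 * r = rho xi r.
Proof.
move=> rxi0; apply/eqP; rewrite -subr_eq0 mulrC -covariantE.
by rewrite -[r]mulr1 (connection_scale nablaP) rxi0 covariant0.
Qed.

(** Flatness at 1, where by [covariantE] the two products of the values at 1
    cancel. *)
Lemma flat_commuting xi zeta : is_flat br nabla -> br xi zeta = 0 ->
  rho zeta (covariant nabla xi 1) = rho xi (covariant nabla zeta 1).
Proof.
move=> flat br0; have := flat xi zeta 1; rewrite br0 covariant0 addr0.
rewrite (covariantE xi (covariant _ _ _)) (covariantE zeta (covariant _ _ _)).
by rewrite mulrC => /eqP; rewrite addrC opprB addrA subrK subr_eq0 => /eqP.
Qed.

End RightConnection.

(** * Existence, and the obstruction to right connections *)

Theorem theorem1p2 (k : fieldType) (A : comPzRingType)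
    (eta : {rmorphism k -> A}) (J : A -> A -> A)
    (J_jacobi : is_jacobi_bracket eta J) (h : A)
    (annJ : forall r, r \in annihilator h -> forall a b, r * J a b = 0) :
  (exists br rho, is_jacobi_lie_rinehart eta J h br rho)
  /\
  (forall br rho, is_jacobi_lie_rinehart eta J h br rho ->
   forall nabla : connection_domain eta (ideal_tensor eta h) -> A,
     is_right_connection rho nabla ->
     (exists a : A, forall r, r \in annihilator h -> a * r = J 1 r)
     /\
     (is_flat br nabla ->
      forall b, J 1 b = 0 ->
      exists a : A, (forall r, r \in annihilator h -> a * r = J 1 r)
                    /\ exists c, J b a = J 1 c)).
Proof.
split.
  by do 2!eexists; exact: (jacobi_lie_rinehart J_jacobi annJ).
move=> br rho [brP rho_gen br_gen] nabla nablaP.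
pose a := covariant nabla (gen_tens eta h 1) 1.
have rho1 c : rho (gen_tens eta h 1) c = J 1 c.
  by rewrite rho_gen /hamiltonian (jacobi_alternating J_jacobi) mul0r addr0.
have aP r : r \in annihilator h -> a * r = J 1 r.
  by move=> rh; rewrite -rho1 (covariant_torsion brP nablaP) ?ann_scale.
split=> [|flat b b1]; first by exists a.
exists a; split=> //; exists (covariant nabla (gen_tens eta h b) 1).
rewrite -rho1 -(flat_commuting brP nablaP flat) ?br_gen ?b1 ?gen_tens0 //.
by rewrite rho_gen /hamiltonian b1 mul0r addr0.
Qed.
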